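(* Let $(B,d)$ be a compact metric space, and let $A_n\subset B$ ($n\ge1$) and $A\subset B$ be compact sets with $\lim_{n\to\infty}\delta(A_n,A)=0$, where $\delta$ is the Hausdorff metric. Let $R_n\in\mathcal{RM}(A_n)\cap C(A_n^2)$ for $n\ge1$ and let $R$ be a metric on $A$. Assume that $R_n\rightarrowtail R$. Then $R\in\mathcal{RM}(A)\cap C(A^2)$. Let $(\mathcal{E}_n,\mathcal{F}_n)$ be the resistance form associated with $R_n$ for $n\ge1$, and let $(\mathcal{E},\mathcal{F})$ be the resistance form associated with $R$. Then $(\mathcal{E}_n,\mathcal{F}_n)$ $\Gamma$-converges to $(\mathcal{E},\mathcal{F})$ on $C(B)$.
   Context: **Hausdorff metric.** $\delta(A,A')=\inf\{\rho>0:A\subset B_\rho(A')\text{ and }A'\subset B_\rho(A)\}$, with $B_\rho(A)=\bigcup_{x\in A}\{y\in B:d(x,y)<\rho\}$. Spaces $C(B),C(A_n),C(A),C(A_n^2),C(A^2)$ of continuous functions are taken with respect to $d$. **Resistance metrics.** A resistance form on a finite set $V$ is a quadratic form $\mathcal{E}_V(f)=\frac12\sum_{x\ne y}c_{x,y}(f(x)-f(y))^2$ on the space $l(V)$ of real functions on $V$, with $c_{x,y}=c_{y,x}\in[0,\infty)$, such that $\mathcal{E}_V(f)=0$ iff $f$ is constant. $R:X\times X\to\mathbb{R}$ is a resistance metric on a set $X$ if for any finite $V\subset X$ there is a resistance form $\mathcal{E}_V$ on $V$ with $R(x,y)=\sup\{|f(x)-f(y)|^2/\mathcal{E}_V(f):f\in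 l(V)\text{ nonconstant}\}$ for $x,y\in V$. $\mathcal{RM}(X)$ is the set of resistance metrics on $X$. **Resistance forms.** A resistance form on a set $X$ is a pair $(\mathcal{E},\mathcal{F})$ such that: (RF1) $\mathcal{F}$ is a linear space of real functions on $X$ containing constants, $\mathcal{E}$ is a nonnegative symmetric quadratic form on $\mathcal{F}$, and $\mathcal{E}(f):=\mathcal{E}(f,f)=0$ iff $f$ is constant; (RF2) $(\mathcal{F}/\text{constants},\mathcal{E})$ is a Hilbert space; (RF3) for any finite $V\subset X$ and $u:V\to\mathbb{R}$ there is $f\in\mathcal{F}$ with $f|_V=u$; (RF4) for distinct $p,q\in X$, $\sup\{|f(p)-f(q)|^2/\mathcal{E}(f):f\in\mathcal{F}\text{ nonconstant}\}<\infty$; (RF5) if $f\in\mathcal{F}$ then $\bar f=(f\vee0)\wedge1\in\mathcal{F}$ and $\mathcal{E}(\bar f)\le\mathcal{E}(f)$. If $R$ is a resistance metric on $X$ with $(X,R)$ separable, there is a unique resistance form $(\mathcal{E},\mathcal{F})$ on $X$ for which the supremum in (RF4) equals $R(p,q)$ for all $p\neq q$ (Kigami); it is the resistance form associated with $R$. **Convergence $\rightarrowtail$.** $R_n\rightarrowtail R$ means: for any $x,y\in A$ and $x_n,y_n\in A_n$ with $x_n\to x$, $y_n\to y$ in $(B,d)$, $R_n(x_n,y_n)\to R(x,y)$. **$\Gamma$-convergence on $C(B)$.** Convention: a form takes the value $+\infty$ off its domain. $(\mathcal{E}_n,\mathcal{F}_n)$ $\Gamma$-converges to $(\mathcal{E},\mathcal{F})$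 on $C(B)$ if: (a) whenever $f_n,f\in C(B)$ and $f_n\to f$ uniformly on $B$, $\mathcal{E}(f|_A)\le\liminf_n\mathcal{E}_n(f_n|_{A_n})$; (b) for each $f\in C(B)$ there are $f_n\in C(B)$ with $f_n\to f$ uniformly on $B$ and $\mathcal{E}(f|_A)=\lim_n\mathcal{E}_n(f_n|_{A_n})$. *)

(* Defs.v *)
From HB Require Import structures.
From mathcomp Require Export all_boot all_order all_algebra finmap.
From mathcomp Require Export all_classical all_reals all_analysis.
Export numFieldNormedType.Exports.
Export Order.TTheory GRing.Theory Num.Theory.

Set Implicit Arguments.
Unset Strict Implicit.
Unset Printing Implicit Defensive.

Local Open Scope classical_set_scope.
Local Open Scope ring_scope.

Section Hausdorff.
Context {R : realType} {B : metricType R}.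

Definition neighborhood (rho : R) (A : set B) : set B :=
  \bigcup_(x in A) [set y | mdist x y < rho].

(* The infimum is taken in the extended reals, so that it is +oo (and not the
   default value 0 of a real infimum) when no rho is admissible, e.g. when
   exactly one of the two sets is empty. *)
Definition hausdorff_dist (A A' : set B) : \bar R :=
  ereal_inf [set rho%:E | rho in
    [set rho : R | [/\ 0 < rho, A `<=` neighborhood rho A'
                              & A' `<=` neighborhood rho A]]].

End Hausdorff.

Definition is_metric {R : realType} {X : Type} (r : X -> X -> R) : Prop :=
  [/\ forall x y, 0 <= r x y,
      forall x y, r x y = 0 <-> x = y,
      forall x y, r x y = r y x
    & forall x y z, r x z <= r x y + r y z].

Definition constant_fun {R : realType} {X : Type} (f : X -> R) : Prop :=
  exists c : R, f = cst c.

(* sup { |f p - f q|^2 / E f : f in F nonconstant }, as a supremum of a subset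
   of [0, +oo]: adjoining 0 changes nothing when F has a nonconstant element,
   and makes the supremum of the empty set equal to 0 (one-point spaces). *)
Definition resistance_sup {R : realType} {X : Type} (F : set (X -> R))
    (E : (X -> R) -> R) (p q : X) : \bar R :=
  ereal_sup (0%E |` [set (`|f p - f q| ^+ 2 / E f)%:E
                    | f in F `&` [set f | ~ constant_fun f]]).

Definition finite_energy {R : realType} {V : finType} (c : V -> V -> R)
    (f : V -> R) : R :=
  2^-1 * \sum_(x : V) \sum_(y : V | x != y) c x y * (f x - f y) ^+ 2.

Definition finite_resistance_form {R : realType} {V : finType}
    (E : (V -> R) -> R) : Prop :=
  exists c : V -> V -> R,
    [/\ forall x y, 0 <= c x y,
        forall x y, c x y = c y x,
        E = finite_energy c
      & forall f, E f = 0 <-> constant_fun f].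

Definition resistance_metric {R : realType} {X : choiceType}
    (r : X -> X -> R) : Prop :=
  forall V : {fset X}, exists2 E : (V -> R) -> R,
    finite_resistance_form E
    & forall x y : V, (r (val x) (val y))%:E = resistance_sup setT E x y.

(* The fields rf1_* to rf5_* are the axioms (RF1)-(RF5) of Kigami, for the form
   [rf_form] with domain [rf_dom]. The values of [rf_form] outside [rf_dom] are irrelevant. *)
Record resistance_form (R : realType) (X : choiceType) := ResistanceForm {
  rf_dom : set (X -> R);
  rf_form : (X -> R) -> (X -> R) -> R;
  rf1_cst : forall c : R, rf_dom (cst c);
  rf1_add : forall f g, rf_dom f -> rf_dom g -> rf_dom (f \+ g);
  rf1_scale : forall (a : R) f, rf_dom f -> rf_dom (a \*o f);
  rf1_sym : forall f g, rf_dom f -> rf_dom g -> rf_form f g = rf_form g f;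
  rf1_linear : forall (a : R) f g h, rf_dom f -> rf_dom g -> rf_dom h ->
    rf_form (a \*o f \+ g) h = a * rf_form f h + rf_form g h;
  rf1_ge0 : forall f, rf_dom f -> 0 <= rf_form f f;
  rf1_eq0 : forall f, rf_dom f -> (rf_form f f = 0 <-> constant_fun f);
  (* By the previous axioms the form induces an inner product on the quotient of
     the domain by the constants; what remains of the Hilbert property is
     completeness for the norm of this inner product. *)
  rf2_complete : forall u : nat -> X -> R, (forall n, rf_dom (u n)) ->
    (forall e : R, 0 < e -> exists N, forall m n, (N <= m)%N -> (N <= n)%N ->
       Num.sqrt (rf_form (u m \- u n) (u m \- u n)) < e) ->
    exists2 f, rf_dom f
      & Num.sqrt (rf_form (u n \- f) (u n \- f)) @[n --> \oo] --> (0 : R);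
  rf3_extend : forall (V : {fset X}) (u : V -> R),
    exists2 f, rf_dom f & f \o val = u;
  rf4_sup_fin : forall p q : X, p <> q ->
    (resistance_sup rf_dom (fun f => rf_form f f) p q < +oo)%E;
  rf5_markov : forall f, rf_dom f ->
    let fbar := fun x => Num.min (Num.max (f x) 0) 1 in
    rf_dom fbar /\ rf_form fbar fbar <= rf_form f f
}.

Definition associated {R : realType} {X : choiceType}
    (Q : resistance_form R X) (r : X -> X -> R) : Prop :=
  forall p q : X, p <> q ->
    resistance_sup (rf_dom Q) (fun f => rf_form Q f f) p q = (r p q)%:E.

Definition energy {R : realType} {X : choiceType} (Q : resistance_form R X)
    (f : X -> R) : \bar R :=
  if f \in rf_dom Q then (rf_form Q f f)%:E else +oo%E.

Definition metric_cvg {R : realType} {B : metricType R} (A_ : nat -> set B)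
    (A : set B) (r_ : forall n, A_ n -> A_ n -> R) (r : A -> A -> R) : Prop :=
  forall (x y : A) (x_ y_ : forall n, A_ n),
    (val (x_ n) : B) @[n --> \oo] --> (val x : B) ->
    (val (y_ n) : B) @[n --> \oo] --> (val y : B) ->
    r_ n (x_ n) (y_ n) @[n --> \oo] --> r x y.

Definition Gamma_cvg {R : realType} {B : metricType R} (A_ : nat -> set B)
    (A : set B) (Q_ : forall n, resistance_form R (A_ n))
    (Q : resistance_form R A) : Prop :=
  (forall (f_ : nat -> B -> R) (f : B -> R),
     (forall n, continuous (f_ n)) -> continuous f ->
     {uniform, f_ @ \oo --> f} ->
     (energy Q (f \o val) <= limn_einf (fun n => energy (Q_ n) (f_ n \o val)))%E)
  /\
  (forall f : B -> R, continuous f ->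
     exists f_ : nat -> B -> R,
       [/\ forall n, continuous (f_ n),
           {uniform, f_ @ \oo --> f}
         & energy (Q_ n) (f_ n \o val) @[n --> \oo] --> energy Q (f \o val)]).

(* Main.v *)
Require Import Defs.
From mathcomp Require Import ring lra.

(** The energy of a resistance form can be recovered from its resistance metric
    [r] by a formula that only involves finitely many points at a time. Modulo
    constants the domain is a Hilbert space on which increments are bounded
    functionals, and polarization shows that the representer of [f x - f o] is
    the Green function [(r x o + r y o - r x y) / 2] of [y]
    ([green_representer]). Hence, for an arbitrary function [f],
<<
      E f = sup_s (2 sum_i a_i (f x_i - f o) - sum_ij a_i a_j green x_i x_j)
>>
    over finite charges [s = ((a_i, x_i))_i], with value [+oo] exactly off the
    domain ([green_sum_riesz], [charge_pairing_le]), and finite sums of Green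
    functions are dense in energy ([green_sum_dense]).

    For the lower bound of Gamma-convergence, a charge on [A] is moved to nearby
    points of [A_ n]; both terms of the formula converge, so the supremum is lower
    semicontinuous ([Gamma_liminf]). For the recovery sequence, [f] in the domain
    is approximated by a constant plus a sum of Green functions, and the
    corresponding sum of Green functions of [r_ n] has almost the same energy. It
    is also uniformly close to [f] on [A_ n], because convergence along sequences
    is locally uniform ([sequential_locally_uniform]) and [B] is compact
    ([near_hausdorff]); Tietze's theorem extends the small difference to [B]
    ([recovery_approx]), and a diagonal argument concludes.

    That [r] is a resistance metric is a statement about finite sets, where
    it follows from compactness of the conductances ([network_limit]). Its
    continuity is another consequence of local uniformity
    ([metric_cvg_continuous]). *)

Set Implicit Arguments.
Unset Strict Implicit.
Unset Printing Implicit Defensive.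
Local Open Scope classical_set_scope.
Local Open Scope ring_scope.

(** * Riesz representation in a resistance form *)

(** The quadratic polynomial [c t^2 - 2 b t + a] has nonpositive discriminant.
    Both the Cauchy-Schwarz inequality and the first order conditions in the
    Riesz argument are instances. *)
Lemma discriminant_le (R : realFieldType) (a b c : R) :
  0 <= c -> (forall t, 2 * t * b <= a + t ^+ 2 * c) -> b ^+ 2 <= a * c.
Proof.
rewrite le_eqVlt => /orP[/eqP <-|c_gt0] abc.
  suff -> : b = 0 by rewrite expr0n mulr0.
  apply/eqP/negP => /negP b0; have := abc ((a + 1) / (2 * b)).
  rewrite mulr0 addr0 (_ : 2 * _ * b = a + 1); last by field.
  lra.
have := abc (b / c).
rewrite -ler_pdivrMr // -[in X in _ -> X](lerD2r (b ^+ 2 / c)).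
rewrite (_ : 2 * (b / c) * b = b ^+ 2 / c + b ^+ 2 / c); last by field; lra.
by rewrite (_ : (b / c) ^+ 2 * c = b ^+ 2 / c) //; field; lra.
Qed.

Section FormAlgebra.
Context {R : realType} {X : choiceType} (Q : resistance_form R X).
Local Notation dom := (rf_dom Q).
Local Notation E := (rf_form Q).

Lemma dom_lin (a : R) f g : dom f -> dom g -> dom (a \*o f \+ g).
Proof. by move=> df dg; apply: rf1_add => //; apply: rf1_scale. Qed.

Lemma dom_sub f g : dom f -> dom g -> dom (f \- g).
Proof.
move=> df dg; rewrite (_ : f \- g = -1 \*o g \+ f); first exact: dom_lin.
by apply/funext => x /=; ring.
Qed.

Lemma form_linr (a : R) f g h : dom f -> dom g -> dom h ->
  E h (a \*o f \+ g) = a * E h f + E h g.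
Proof.
move=> df dg dh; rewrite rf1_sym ?rf1_linear //; last exact: dom_lin.
by rewrite (rf1_sym df dh) (rf1_sym dg dh).
Qed.

Lemma form_lin_diag (a : R) f g : dom f -> dom g ->
  E (a \*o f \+ g) (a \*o f \+ g) = a ^+ 2 * E f f + 2 * a * E f g + E g g.
Proof.
move=> df dg; rewrite rf1_linear ?form_linr//; last exact: dom_lin.
by rewrite (rf1_sym dg df); ring.
Qed.

(** Constants have zero energy, hence lie in the radical of the form. *)
Lemma form_cst c f : dom f -> E (cst c) f = 0.
Proof.
move=> df; have dc := rf1_cst Q c.
have Ec : E (cst c) (cst c) = 0 by apply/(rf1_eq0 dc); exists c.
have quad t : 2 * t * E (cst c) f <= E f f + t ^+ 2 * 0.
  have := rf1_ge0 (dom_lin (- t) dc df).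
  by rewrite form_lin_diag// Ec; lra.
have := discriminant_le (lexx 0) quad.
by rewrite mulr0 real_exprn_even_le0 ?num_real //= => /eqP.
Qed.

Lemma form_subl f g h : dom f -> dom g -> dom h ->
  E (f \- g) h = E f h - E g h.
Proof.
move=> df dg dh; rewrite (_ : f \- g = -1 \*o g \+ f).
  by rewrite rf1_linear //; ring.
by apply/funext => x /=; ring.
Qed.

Lemma form_sub_diag f g : dom f -> dom g ->
  E (f \- g) (f \- g) = E f f - 2 * E f g + E g g.
Proof.
move=> df dg; rewrite (_ : f \- g = -1 \*o g \+ f).
  by rewrite form_lin_diag// (rf1_sym dg df); ring.
by apply/funext => x /=; ring.
Qed.

Lemma form_CauchySchwarz f g : dom f -> dom g -> E f g ^+ 2 <= E f f * E g g.
Proof.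
move=> df dg; apply: discriminant_le => [|t]; first exact: rf1_ge0.
have := rf1_ge0 (dom_lin (- t) dg df); rewrite form_lin_diag// (rf1_sym dg df).
lra.
Qed.

Lemma form_sub_sym f g : dom f -> dom g ->
  E (g \- f) (g \- f) = E (f \- g) (f \- g).
Proof. by move=> df dg; rewrite !form_sub_diag// (rf1_sym df dg); ring. Qed.

Section Riesz.
(* The subspace on which the functional lives is the range of a family [h], and
   the functional is read off the indices: a family of formal sums can then be
   used without checking that the functional only depends on the sum. *)
Context (T : Type) (h : T -> X -> R) (L : T -> R) (M : R).
Hypothesis T0 : T.
Hypothesis dom_h : forall s, dom (h s).
Hypothesis lin : forall a s t, exists u,
  h u = a \*o h s \+ h t /\ L u = a * L s + L t.
Hypothesis bounded : forall s, 2 * L s - E (h s) (h s) <= M.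

Let J s := 2 * L s - E (h s) (h s).
Let m := sup (range J).

Lemma riesz_J_le s : J s <= m.
Proof.
apply: ub_le_sup; last by exists s.
by exists M => _ [u _ <-]; exact: bounded.
Qed.

Lemma riesz_maximizing e : 0 < e -> exists s, m - e < J s.
Proof.
move=> e0; have [] := @sup_adherent R (range J) e e0.
  split; first by exists (J T0); exists T0.
  by exists M => _ [u _ <-]; exact: bounded.
by move=> _ [s _ <-] Js; exists s.
Qed.

Lemma riesz_first_order e s t : m - e < J s ->
  (L t - E (h s) (h t)) ^+ 2 <= e * E (h t) (h t).
Proof.
move=> Js; apply: discriminant_le => [|a]; first exact: rf1_ge0.
have [u [hu Lu]] := lin a t s.
have Ju : 2 * L u - E (h u) (h u) <= m := riesz_J_le u.
move: Js Ju; rewrite /J hu Lu form_lin_diag// (rf1_sym (dom_h t)) //.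
lra.
Qed.

(** This is the parallelogram identity, applied to the midpoint. *)
Lemma riesz_near e s t : m - e < J s -> m - e < J t ->
  E (h s \- h t) (h s \- h t) < 4 * e.
Proof.
move=> Js Jt; have [u [hu Lu]] := lin 1 s t.
(* [w] is the midpoint of [s] and [t]: [a u + u] with [1 + a = 1 / 2]. *)
have [w [hw Lw]] := lin (2^-1 - 1) u u.
have Jw : 2 * L w - E (h w) (h w) <= m := riesz_J_le w.
move: Js Jt Jw; rewrite /J hw Lw form_lin_diag// hu Lu form_lin_diag//.
rewrite form_sub_diag //; lra.
Qed.

(** A maximizing sequence of the concave functional [2 L - E] is Cauchy by
    [riesz_near], and its limit represents [L] by [riesz_first_order]. The last
    conclusion records that the representative is approximated from the
    subspace. *)
Lemma riesz : exists2 g, dom g &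
  [/\ forall s, E g (h s) = L s, E g g <= M &
      forall e, 0 < e -> exists s, E (g \- h s) (g \- h s) < e].
Proof.
have /choice[u uP] : forall n, exists s, m - n.+1%:R^-1 < J s.
  by move=> n; apply: riesz_maximizing; rewrite invr_gt0.
have uN e : 0 < e -> exists N, forall n, (N <= n)%N -> m - e < J (u n).
  move=> e0; have [N _ NP] := near_infty_natSinv_lt (PosNum e0).
  exists N => n Nn; apply: lt_trans (uP n); rewrite ltrD2l ltrN2.
  exact: (NP n Nn).
have [g dg ug] : exists2 g, dom g &
   Num.sqrt (E (h (u n) \- g) (h (u n) \- g)) @[n --> \oo] --> (0 : R).
  apply: rf2_complete => [n|e e0]; first exact: dom_h.
  have e4 : 0 < e ^+ 2 / 4 by rewrite divr_gt0 ?exprn_gt0.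
  have [N NP] := uN _ e4.
  exists N => a b /NP Ja /NP Jb; have := riesz_near Ja Jb.
  rewrite (_ : 4 * (e ^+ 2 / 4) = e ^+ 2); last by field.
  by move=> ab; rewrite -[ltRHS](ger0_norm (ltW e0)) -sqrtr_sqr ltr_sqrt ?exprn_gt0.
have dense e : 0 < e -> exists s, E (g \- h s) (g \- h s) < e /\ m - e < J s.
  move=> e0; have [N NP] := uN _ e0.
  move/cvgrPdist_lt : ug => /(_ (Num.sqrt e)).
  rewrite sqrtr_gt0 => /(_ e0)[N' _ N'P].
  exists (u (maxn N N')); split; last exact/NP/leq_maxl.
  have := N'P _ (leq_maxr N N'); rewrite sub0r normrN ger0_norm ?sqrtr_ge0//.
  by rewrite ltr_sqrt// form_sub_sym.
have repr t : E g (h t) = L t.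
  apply/eqP; rewrite -subr_eq0 -normr_le0; apply/ler_addgt0Pl => e e0.
  rewrite addr0.
  set k := 1 + E (h t) (h t); have k0 : 0 < k.
    by rewrite /k; have := rf1_ge0 (dom_h t); lra.
  have ek : 0 < e ^+ 2 / 4 / k by rewrite !divr_gt0 ?exprn_gt0.
  have [s [s1 s2]] := dense _ ek.
  have half x : x ^+ 2 <= e ^+ 2 / 4 / k * E (h t) (h t) -> `|x| <= e / 2.
    move=> xs; rewrite -(@ler_pXn2r _ 2) ?nnegrE ?divr_ge0 ?(ltW e0)//.
    rewrite real_normK ?num_real//; apply: le_trans xs _.
    rewrite expr_div_n (_ : 2 ^+ 2 = 4); last by rewrite -natrX.
    rewrite -mulrA ler_piMr ?divr_ge0 ?exprn_ge0 ?(ltW e0)//.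
    by rewrite mulrC ler_pdivrMr// /k; lra.
  have /half := riesz_first_order t s2.
  have /half : E (g \- h s) (h t) ^+ 2 <= e ^+ 2 / 4 / k * E (h t) (h t).
    apply: le_trans (form_CauchySchwarz (dom_sub dg (dom_h s)) (dom_h t)) _.
    by rewrite ler_wpM2r ?(ltW s1)// rf1_ge0.
  rewrite form_subl// => a b.
  have := ler_normB (E g (h t) - E (h s) (h t)) (L t - E (h s) (h t)).
  rewrite (_ : _ - _ - _ = E g (h t) - L t); last by ring.
  lra.
exists g => //; split=> [//||e /dense[s []]]; last by exists s.
apply/ler_addgt0Pr => e /dense[s []].
rewrite form_sub_diag// repr => + _.
have := bounded s; lra.
Qed.

End Riesz.
End FormAlgebra.

(** * Green functions and the dual formula for the energy *)

(** The Green function with pole [o], as it appears in the polarization of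
    [r x y], the squared distance of the representers of [x] and [y]. *)
Definition green {R : realType} {X : Type} (r : X -> X -> R) (o x y : X) : R :=
  (r x o + r y o - r x y) / 2.

(** Formal finite sums of pairs (coefficient, point) encode finitely supported
    charges; [green_sum] is the potential of the charge and [green_energy] its
    energy. *)
Definition green_sum {R : realType} {X : Type} (r : X -> X -> R) (o : X)
    (s : seq (R * X)) (y : X) : R :=
  \sum_(t <- s) t.1 * green r o t.2 y.

Definition green_energy {R : realType} {X : Type} (r : X -> X -> R) (o : X)
    (s : seq (R * X)) : R :=
  \sum_(t <- s) t.1 * green_sum r o s t.2.

Definition charge_pairing {R : realType} {X : Type} (f : X -> R) (o : X)
    (s : seq (R * X)) : R :=
  \sum_(t <- s) t.1 * (f t.2 - f o).

Section ResistanceSup.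
Context {R : realType} {X : Type} (F : set (X -> R)) (E : (X -> R) -> R).
Hypothesis E_ge0 : forall f, F f -> 0 <= E f.
Hypothesis E_eq0 : forall f, F f -> E f = 0 -> constant_fun f.

Lemma form_gt0 f : F f -> ~ constant_fun f -> 0 < E f.
Proof.
move=> Ff nf; rewrite lt0r E_ge0// andbT.
by apply/eqP => /(E_eq0 Ff).
Qed.

Lemma resistance_sup_ge0 p q : (0 <= resistance_sup F E p q)%E.
Proof. by apply: ereal_sup_ubound; left. Qed.

Lemma resistance_sup_xx p : resistance_sup F E p p = 0%E.
Proof.
apply/eqP; rewrite eq_le resistance_sup_ge0 andbT.
apply: ge_ereal_sup => _ [->//|[f _ <-]].
by rewrite subrr normr0 expr0n mul0r.
Qed.

(** The bound by the supremum extends to the constant functions, which the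
    supremum leaves out. *)
Lemma sqr_diff_le p q rho f : resistance_sup F E p q = rho%:E ->
  F f -> (f p - f q) ^+ 2 <= rho * E f.
Proof.
move=> rhoE Ff.
have rho0 : 0 <= rho by rewrite -lee_fin -rhoE resistance_sup_ge0.
have [[c fc]|nf] := pselect (constant_fun f).
  by rewrite {1 2}fc /= subrr expr0n mulr_ge0// E_ge0.
rewrite -ler_pdivrMr; last exact: form_gt0.
rewrite -lee_fin -rhoE; apply: ereal_sup_ubound; right.
by exists f => //; rewrite real_normK ?num_real.
Qed.

End ResistanceSup.

Section ReproducingKernel.
Context {R : realType} {X : choiceType}.
Variables (Q : resistance_form R X) (r : X -> X -> R).
Hypothesis rxx : forall x, r x x = 0.
Hypothesis Qr : associated Q r.
Local Notation dom := (rf_dom Q).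
Local Notation E := (rf_form Q).

Let E_ge0 : forall f, dom f -> 0 <= E f f.
Proof. exact: rf1_ge0. Qed.

Let E_eq0 f : dom f -> E f f = 0 -> constant_fun f.
Proof. by move=> df /(rf1_eq0 df). Qed.

Let E_gt0 f : dom f -> ~ constant_fun f -> 0 < E f f.
Proof. exact: (form_gt0 E_ge0 E_eq0). Qed.

Lemma assoc p q : resistance_sup dom (fun f => E f f) p q = (r p q)%:E.
Proof.
have [->|/eqP pq] := eqVneq p q; first by rewrite rxx resistance_sup_xx.
exact: Qr.
Qed.

Lemma form_sqr_diff_le p q f : dom f -> (f p - f q) ^+ 2 <= r p q * E f f.
Proof. exact: (sqr_diff_le E_ge0 E_eq0 (assoc p q)). Qed.

Lemma form_shift c f g : dom g -> (forall x, f x = g x + c) ->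
  dom f /\ E f f = E g g.
Proof.
move=> dg fg; have -> : f = 1 \*o g \+ cst c by apply/funext=> x /=; rewrite fg; ring.
have dc := rf1_cst Q c.
split; first exact: dom_lin.
rewrite form_lin_diag// (rf1_sym dg dc) !form_cst//; ring.
Qed.

Lemma assoc_ge0 p q : 0 <= r p q.
Proof. by rewrite -lee_fin -assoc resistance_sup_ge0. Qed.

(** The resistance is the energy of the element that represents the increment
    [f p - f q], by the equality case of the Cauchy-Schwarz inequality. *)
Lemma representer_energy p q g : dom g ->
  (forall f, dom f -> E f g = f p - f q) -> E g g = r p q.
Proof.
move=> dg gP.
apply/eqP; rewrite eq_le; apply/andP; split.
  have [->|Eg0] := eqVneq (E g g) 0; first exact: assoc_ge0.
  have Eg_gt0 : 0 < E g g by rewrite lt0r Eg0 rf1_ge0.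
  by have := form_sqr_diff_le p q dg; rewrite -gP// expr2 ler_pM2r.
rewrite -lee_fin -assoc; apply: ge_ereal_sup => _ [->|[f [df nf] <-]].
  by rewrite lee_fin rf1_ge0.
rewrite lee_fin real_normK ?num_real// ler_pdivrMr; last exact: E_gt0.
by rewrite -gP// mulrC; exact: form_CauchySchwarz.
Qed.

Lemma increment_representer p q : exists2 g, dom g &
  forall f, dom f -> E f g = f p - f q.
Proof.
have [|||g dg [gP _ _]] := @riesz R X Q {f | dom f} (fun f => sval f)
   (fun f => sval f p - sval f q) (r p q) (exist _ _ (rf1_cst Q 0)).
- by case.
- move=> a [f df] [g dg] /=; exists (exist _ _ (dom_lin a df dg)) => /=.
  by split=> //; ring.
- move=> [f df] /=; have := form_sqr_diff_le p q df.
  have := assoc_ge0 p q; have := rf1_ge0 df.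
  set b := f p - f q; set c := E f f; set M := r p q => c0 M0 bMc.
  have := sqr_ge0 (M - c); rewrite leNgt => Mc; apply/negP => cb; nra.
- exists g => // f df; rewrite (rf1_sym df dg).
  exact: (gP (exist _ f df)).
Qed.

(** Two increments based at [o] have inner product given by polarization of the
    resistances, so the representer of [f x - f o] vanishing at [o] is the Green
    function. *)
Lemma green_representer o x : dom (green r o x) /\
  forall f, dom f -> E f (green r o x) = f x - f o.
Proof.
have [k dk kP] := increment_representer x o.
have kE z : k z = green r o x z + k o.
  have [l dl lP] := increment_representer z o.
  have kl : r x o - 2 * (k z - k o) + r z o = r x z.
    rewrite -(representer_energy dk kP) -(representer_energy dl lP) -lP//.
    rewrite -form_sub_diag//; apply: representer_energy (dom_sub dk dl) _ => f df.
    rewrite rf1_sym// ?form_subl//; last exact: dom_sub.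
    by rewrite (rf1_sym dk df) (rf1_sym dl df) kP// lP//; ring.
  by rewrite /green -kl; field.
have gE : green r o x = k \- cst (k o).
  by apply/funext => z /=; rewrite kE; ring.
have dc := rf1_cst Q (k o).
have dg : dom (green r o x) by rewrite gE; apply: dom_sub.
split=> // f df; rewrite rf1_sym// gE form_subl// form_cst// subr0.
by rewrite rf1_sym ?kP.
Qed.

Variable o : X.

Lemma green_sum_base s : green_sum r o s o = 0.
Proof.
rewrite /green_sum big1// => t _.
by rewrite /green rxx addr0 subrr mul0r mulr0.
Qed.

Lemma green_sum_cons t s :
  green_sum r o (t :: s) = t.1 \*o green r o t.2 \+ green_sum r o s.
Proof. by apply/funext => y; rewrite /green_sum big_cons. Qed.

Lemma green_sum_representer s : dom (green_sum r o s) /\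
  forall f, dom f -> E f (green_sum r o s) = charge_pairing f o s.
Proof.
elim: s => [|t s [ds IHs]].
  have -> : green_sum r o [::] = cst 0.
    by apply/funext => y; rewrite /green_sum big_nil.
  have dc := rf1_cst Q 0; split=> // f df.
  by rewrite rf1_sym// form_cst// /charge_pairing big_nil.
have [dt gP] := green_representer o t.2.
rewrite green_sum_cons; split; first exact: dom_lin.
move=> f df; rewrite form_linr// gP// IHs//.
by rewrite /charge_pairing big_cons.
Qed.

Lemma green_sum_energy s :
  E (green_sum r o s) (green_sum r o s) = green_energy r o s.
Proof.
have [ds sP] := green_sum_representer s.
rewrite sP// /charge_pairing /green_energy; apply: eq_bigr => t _.
by rewrite green_sum_base subr0.
Qed.

(** The dual description of the energy: the quadratic functionals of finite
    charges on the left only involve [f] and [r] on finitely many points, and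
    their supremum detects membership in the domain as well as the energy. The
    approximation by potentials of charges comes with the same maximization. *)
Lemma green_sum_riesz f M :
  (forall s, 2 * charge_pairing f o s - green_energy r o s <= M) ->
  [/\ dom f, E f f <= M & forall e, 0 < e -> exists s,
     E (f \- green_sum r o s) (f \- green_sum r o s) < e].
Proof.
move=> fM.
have [|||g dg [gP gM dense]] := @riesz R X Q (seq (R * X)) (green_sum r o)
   (charge_pairing f o) M [::].
- by move=> s; have [] := green_sum_representer s.
- move=> a s t; exists ([seq (a * u.1, u.2) | u <- s] ++ t); split.
    apply/funext => y; rewrite /green_sum /= big_cat big_map mulr_sumr /=.
    by congr +%R; apply: eq_bigr => u _; rewrite mulrA.
  rewrite /charge_pairing big_cat big_map mulr_sumr /=.
  by congr +%R; apply: eq_bigr => u _; rewrite mulrA.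
- by move=> s; rewrite green_sum_energy.
have fg x : f x = g x + (f o - g o).
  have := gP [:: (1, x)]; have [_ ->//] := green_sum_representer [:: (1, x)].
  by rewrite /charge_pairing !big_seq1 /=; lra.
have [df fE] := form_shift dg fg.
split; rewrite ?fE// => e /dense[s sE]; exists s.
have [ds _] := green_sum_representer s.
have [|_ ->//] := @form_shift (f o - g o) (f \- green_sum r o s)
  (g \- green_sum r o s) (dom_sub dg ds).
by move=> x /=; rewrite fg; ring.
Qed.

Lemma charge_pairing_le f s : dom f ->
  2 * charge_pairing f o s - green_energy r o s <= E f f.
Proof.
move=> df; have [ds sP] := green_sum_representer s.
have := rf1_ge0 (dom_sub df ds).
by rewrite form_sub_diag// sP// green_sum_energy; lra.
Qed.

Lemma green_sum_dense f e : dom f -> 0 < e -> exists s,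
  E (f \- green_sum r o s) (f \- green_sum r o s) < e /\
  `|E f f - green_energy r o s| < e.
Proof.
move=> df e0; have E0 := rf1_ge0 df.
have K0 : 0 < 1 + E f f by lra.
pose d := Num.min (e / 2) ((e / 4) ^+ 2 / (1 + E f f)).
have d0 : 0 < d by rewrite lt_min !divr_gt0// exprn_gt0 ?divr_gt0.
have [_ _ /(_ _ d0)[s sd]] := green_sum_riesz (fun s => charge_pairing_le s df).
exists s; have [ds sP] := green_sum_representer s.
have e2 : d <= e / 2 by rewrite ge_min lexx.
have dK : d * (1 + E f f) <= (e / 4) ^+ 2.
  by rewrite -ler_pdivlMr// ge_min lexx orbT.
have dfs := dom_sub df ds.
have Es0 := rf1_ge0 dfs.
have small : `|E (f \- green_sum r o s) f| <= e / 4.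
  rewrite -(@ler_pXn2r _ 2) ?nnegrE//; last by rewrite divr_ge0// ltW.
  rewrite real_normK ?num_real//; apply: le_trans (form_CauchySchwarz dfs df) _.
  by apply: le_trans _ dK; apply: ler_pM => //; [exact: ltW | lra].
split; first by lra.
have -> : E f f - green_energy r o s = 2 * E (f \- green_sum r o s) f
    - E (f \- green_sum r o s) (f \- green_sum r o s).
  rewrite form_sub_diag// form_subl// (rf1_sym ds df) green_sum_energy; ring.
by move: small; rewrite ler_norml ltr_norml => /andP[? ?]; lra.
Qed.

End ReproducingKernel.

(** * Limits of finite networks *)

Lemma cvg_sum (R : realType) (I T : Type) (F : set_system T) (s : seq I)
    (P : pred I) (u : I -> T -> R) (l : I -> R) : Filter F ->
  (forall i, P i -> u i x @[x --> F] --> l i) ->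
  \sum_(i <- s | P i) u i x @[x --> F] --> \sum_(i <- s | P i) l i.
Proof.
by move=> FF uP; apply: cvg_big => [|i Pi]; [exact: add_continuous|exact: uP].
Qed.

Section FiniteEnergy.
Context {R : realType} {I : finType}.
Implicit Types (c : I -> I -> R) (f : I -> R).

Lemma finite_energy_ge0 c f : (forall i j, 0 <= c i j) -> 0 <= finite_energy c f.
Proof.
move=> c0; rewrite mulr_ge0 ?invr_ge0//; apply: sumr_ge0 => i _.
by apply: sumr_ge0 => j _; rewrite mulr_ge0 ?sqr_ge0.
Qed.

Lemma finite_energy_affine c f a b :
  finite_energy c (fun i => (f i - b) * a) = finite_energy c f * a ^+ 2.
Proof.
rewrite /finite_energy -mulrA mulr_suml; congr (_ * _); apply: eq_bigr => i _.
rewrite mulr_suml; apply: eq_bigr => j _.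
by rewrite -mulrBl (_ : f i - b - (f j - b) = f i - f j); ring.
Qed.

Lemma finite_energy_cst c f : constant_fun f -> finite_energy c f = 0.
Proof.
move=> [a ->]; rewrite /finite_energy big1 ?mulr0// => i _.
by rewrite big1// => j _; rewrite /= subrr expr0n mulr0.
Qed.

Lemma finite_energy_edge c f i j : (forall i j, 0 <= c i j) ->
  (forall i j, c i j = c j i) -> i != j ->
  c i j * (f i - f j) ^+ 2 <= finite_energy c f.
Proof.
move=> c0 cs ij; have term0 k l : 0 <= c k l * (f k - f l) ^+ 2.
  by rewrite mulr_ge0 ?sqr_ge0.
have row k l : k != l -> c k l * (f k - f l) ^+ 2 <=
    \sum_(m | k != m) c k m * (f k - f m) ^+ 2.
  by move=> kl; rewrite (bigD1 l)//= lerDl sumr_ge0.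
have row0 k : 0 <= \sum_(m | k != m) c k m * (f k - f m) ^+ 2.
  by apply: sumr_ge0.
rewrite /finite_energy (bigD1 i)// (bigD1 j) 1?eq_sym//=.
have rest := @sumr_ge0 R I (index_enum I) (fun k => (k != i) && (k != j)) _
  (fun k _ => row0 k).
have := row i j ij; have := row j i; rewrite eq_sym => /(_ ij).
rewrite (cs j i) -(opprB (f i)) sqrrN => rj ri.
set S := \sum_(_ | _ && _) _ in rest *; lra.
Qed.

Lemma cvg_finite_energy (T : Type) (G : set_system T) (c_ : T -> I -> I -> R) c
    (f_ : T -> I -> R) f : Filter G ->
  (forall i j, i != j -> c_ n i j @[n --> G] --> c i j) ->
  (forall i, f_ n i @[n --> G] --> f i) ->
  finite_energy (c_ n) (f_ n) @[n --> G] --> finite_energy c f.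
Proof.
move=> FG cP fP; apply: cvgMr; apply: cvg_sum => i _; apply: cvg_sum => j ij.
have cf : (f_ n i - f_ n j) @[n --> G] --> f i - f j by exact: cvgB.
by apply: cvgM; [exact: cP|exact: (cvgM cf cf)].
Qed.

(** An electrical network on [I] with conductances [c] and effective resistances
    [rho]. *)
Definition network c (rho : I -> I -> R) := [/\ forall i j, 0 <= c i j,
  forall i j, c i j = c j i,
  forall f, finite_energy c f = 0 <-> constant_fun f
  & forall i j, (rho i j)%:E = resistance_sup setT (finite_energy c) i j].

Section Network.
Variables (c : I -> I -> R) (rho : I -> I -> R).
Hypothesis net : network c rho.

Lemma network_sqr_diff_le f i j : (f i - f j) ^+ 2 <= rho i j * finite_energy c f.
Proof.
have [c0 _ cE rhoE] := net; apply: sqr_diff_le (esym (rhoE i j)) _ => //.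
- by move=> g _; exact: finite_energy_ge0.
- by move=> g _ /cE.
Qed.

Lemma network_energy_gt0 f : ~ constant_fun f -> 0 < finite_energy c f.
Proof.
have [c0 _ cE _] := net => nf; rewrite lt0r finite_energy_ge0// andbT.
by apply/eqP => /cE.
Qed.

(** Deleting all other edges can only increase the effective resistance, up to
    the resistance [1 / c i j] of the single edge. *)
Lemma network_conductance_le i j : i != j -> c i j * rho i j <= 1.
Proof.
have [c0 cs cE rhoE] := net => ij.
have [->|cij] := eqVneq (c i j) 0; first by rewrite mul0r.
have cij0 : 0 < c i j by rewrite lt0r cij c0.
rewrite mulrC -ler_pdivlMr// -lee_fin rhoE.
apply: ge_ereal_sup => _ [->|[f [_ nf] <-]].
  by rewrite lee_fin divr_ge0.
have Ef := network_energy_gt0 nf.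
rewrite lee_fin real_normK ?num_real// ler_pdivrMr// mul1r mulrC ler_pdivlMr//.
by rewrite mulrC; exact: finite_energy_edge.
Qed.

(** A nearly optimal function for the supremum, normalized to be comparable along
    a sequence of networks. *)
Lemma network_potential i j m : 0 <= m < rho i j -> exists f,
  [/\ finite_energy c f = 1, f i = 0 & m < (f j) ^+ 2].
Proof.
have [c0 cs cE rhoE] := net => /andP[m0].
rewrite -lte_fin rhoE => /ereal_sup_gt[_ [->|[f [_ nf] <-]]].
  by rewrite lte_fin ltNge m0.
have Ef := network_energy_gt0 nf.
rewrite lte_fin real_normK ?num_real// => mf.
exists (fun k => (f k - f i) * (Num.sqrt (finite_energy c f))^-1); split.
- by rewrite finite_energy_affine exprVn sqr_sqrtr ?mulfV ?gt_eqF// ltW.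
- by rewrite subrr mul0r.
by rewrite exprMn exprVn sqr_sqrtr ?ltW// -(opprB (f i)) sqrrN.
Qed.

End Network.
End FiniteEnergy.

Lemma ultra_fmap (T U : Type) (G : set_system T) (u : T -> U) :
  UltraFilter G -> UltraFilter (u @ G).
Proof.
move=> GU; split; first exact: fmap_proper_filter.
move=> H HH GH; apply/seteqP; split=> // S HS.
have [//|nS] := in_ultra_setVsetC (u @^-1` S) GU.
exfalso; have /filter_ex[x []] : H (S `&` ~` S) by apply: filterI => //; exact: GH.
exact.
Qed.

Lemma ultra_bounded_cvg (R : realType) (T : Type) (G : set_system T)
    (u : T -> R) (M : R) : UltraFilter G ->
  (\forall n \near G, `|u n| <= M) -> exists l : R, u @ G --> l.
Proof.
move=> GU uM; have := @segment_compact R (- M) M.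
rewrite compact_ultra => /(_ _ (ultra_fmap u GU)) [|l [_ ul]]; last by exists l.
by apply: filterS uM => n /=; rewrite in_itv /= ler_norml.
Qed.

(** Compactness: the conductances stay below the inverse resistances, which
    converge, so they converge along an ultrafilter. The bounds
    [network_sqr_diff_le] pass to the limit and show that the limiting network
    is connected with resistances at most [rho]; unit energy potentials that
    nearly realize the resistances are bounded and also converge, which gives the
    reverse inequality. *)
Lemma network_limit (R : realType) (I : finType) (rho_ : nat -> I -> I -> R)
    (rho : I -> I -> R) :
  (\forall n \near \oo, exists c, network c (rho_ n)) ->
  (forall i j, rho_ n i j @[n --> \oo] --> rho i j) ->
  (forall i, rho i i = 0) -> (forall i j, i != j -> 0 < rho i j) ->
  exists c, network c rho.
Proof.
move=> net_ex rhoP rho0 rho_gt0.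
have [c_ c_P] : exists c_, \forall n \near \oo, network (c_ n) (rho_ n).
  have /choice[c_ cP] : forall n, exists c, (exists c', network c' (rho_ n)) ->
      network c (rho_ n).
    move=> n; have [[c cn]|nc] := pselect (exists c', network c' (rho_ n)).
      by exists c.
    by exists (fun _ _ => 0) => /nc.
  by exists c_; apply: filterS net_ex => n /cP.
have [G [GU ooG]] := @ultraFilterLemma nat \oo _.
have rhoG i j : rho_ n i j @[n --> G] --> rho i j.
  by apply: cvg_trans (rhoP i j); apply: cvg_fmap2.
have netG : \forall n \near G, network (c_ n) (rho_ n) by exact: ooG.
have /choice[l lP] : forall ij : I * I, exists l : R,
    ij.1 != ij.2 -> c_ n ij.1 ij.2 @[n --> G] --> l.
  move=> [i j] /=; have [->|ij] := eqVneq i j; first by exists 0.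
  have rij := rho_gt0 _ _ ij.
  have [|l] := @ultra_bounded_cvg _ _ G (fun n => c_ n i j) (2 / rho i j) GU.
    have rhalf : rho i j / 2 < rho i j by lra.
    near=> n.
    have net : network (c_ n) (rho_ n) by near: n.
    have rn : rho i j / 2 < rho_ n i j.
      by near: n; exact: (cvgr_gt _ (rhoG i j) _ rhalf).
    have [c0 _ _ _] := net; rewrite ger0_norm// ler_pdivlMr//.
    have := network_conductance_le net ij.
    have := ler_wpM2l (c0 i j) (ltW rn); lra.
  by exists l.
(* On the diagonal [c_] may diverge; the value 0 keeps [c] symmetric and
   nonnegative. *)
pose c i j := if i == j then 0 else l (i, j).
have cP i j : i != j -> c_ n i j @[n --> G] --> c i j.
  by move=> ij; rewrite /c (negbTE ij); exact: (lP (i, j)).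
have c0 i j : 0 <= c i j.
  have [->|ij] := eqVneq i j; first by rewrite /c eqxx.
  by apply: (cvgr_to_ge (cP _ _ ij)); apply: filterS netG => n [].
have cs i j : c i j = c j i.
  have [->//|ij] := eqVneq i j.
  have ji : j != i by rewrite eq_sym.
  apply: (@cvg_unique _ (@Rhausdorff R) _ _ _ _ (cP _ _ ij)).
  apply: cvg_trans (cP _ _ ji); apply: near_eq_cvg.
  by apply: filterS netG => n [_ -> _ _].
have diff f i j : (f i - f j) ^+ 2 <= rho i j * finite_energy c f.
  have Ef : finite_energy (c_ n) f @[n --> G] --> finite_energy c f.
    by apply: cvg_finite_energy => // k; exact: cvg_cst.
  have rE : rho_ n i j * finite_energy (c_ n) f @[n --> G] -->
    rho i j * finite_energy c f by exact: cvgM.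
  apply: (cvgr_to_ge rE).
  by apply: filterS netG => n net; exact: network_sqr_diff_le.
have cE f : finite_energy c f = 0 <-> constant_fun f.
  split=> [Ef|]; last exact: finite_energy_cst.
  have ff i j : f i = f j.
    have := diff f i j; rewrite Ef mulr0 real_exprn_even_le0 ?num_real//=.
    by rewrite subr_eq0 => /eqP.
  have [[i _]|nI] := pselect (exists i : I, True).
    by exists (f i); apply/funext => j; exact: ff.
  by exists 0; apply/funext => i; exfalso; apply: nI; exists i.
exists c; split=> // i j.
have [->|ij] := eqVneq i j; first by rewrite rho0 resistance_sup_xx.
apply/eqP; rewrite eq_le; apply/andP; split; last first.
  apply: ge_ereal_sup => _ [->|[f [_ nf] <-]]; first by rewrite lee_fin ltW ?rho_gt0.
  rewrite lee_fin real_normK ?num_real// ler_pdivrMr//.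
  by rewrite lt0r finite_energy_ge0// andbT; apply/eqP => /cE.
apply/lee_addgt0Pr => e e0.
have rij := rho_gt0 _ _ ij.
pose m := Num.max 0 (rho i j - e).
have [m0 me mr] : [/\ 0 <= m, rho i j - e <= m & m < rho i j].
  by rewrite /m le_max lexx le_max lexx orbT gt_max rij ltrBlDr ltrDl.
have /choice[f_ fP] : forall n, exists f,
    (network (c_ n) (rho_ n) /\ m < rho_ n i j) ->
    [/\ finite_energy (c_ n) f = 1, f i = 0 & m < (f j) ^+ 2].
  move=> n; have [[net mn]|h] := pselect (network (c_ n) (rho_ n) /\ m < rho_ n i j).
    have [|f fE] := network_potential net (i := i) (j := j) (m := m).
      by rewrite m0.
    by exists f.
  by exists (fun=> 0) => /h.
have fG : \forall n \near G,
    [/\ finite_energy (c_ n) (f_ n) = 1, f_ n i = 0 & m < (f_ n j) ^+ 2].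
  near=> n; apply: fP; split; near: n => //.
  exact: (cvgr_gt _ (rhoG i j) _ mr).
have /choice[f f_cvg] : forall k, exists l : R, f_ n k @[n --> G] --> l.
  move=> k; apply: (@ultra_bounded_cvg _ _ G (fun n => f_ n k) (rho i k + 2)) => //.
  have rik : rho i k < rho i k + 1 by lra.
  near=> n.
  have net : network (c_ n) (rho_ n) by near: n.
  have [En fi _] : [/\ finite_energy (c_ n) (f_ n) = 1, f_ n i = 0
    & m < (f_ n j) ^+ 2] by near: n.
  have rn : rho_ n i k < rho i k + 1.
    by near: n; exact: (cvgr_lt _ (rhoG i k) _ rik).
  have := network_sqr_diff_le net (f_ n) i k.
  rewrite En fi mulr1 sub0r sqrrN => fk.
  rewrite -(@ler_pXn2r _ 2) ?nnegrE ?real_normK ?num_real//; last first.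
    by have := le_trans (sqr_ge0 _) fk; lra.
  have := le_trans (sqr_ge0 _) fk; nra.
have Ef : finite_energy c f = 1.
  have E1 : finite_energy (c_ n) (f_ n) @[n --> G] --> (1 : R).
    by apply: cvg_near_cst; apply: filterS fG => n [-> _ _].
  apply: (cvg_unique _ _ E1) => //; exact: cvg_finite_energy.
have fi : f i = 0.
  have f0 : f_ n i @[n --> G] --> (0 : R).
    by apply: cvg_near_cst; apply: filterS fG => n [_ -> _].
  exact: (cvg_unique _ (f_cvg i) f0).
have fj : m <= (f j - f i) ^+ 2.
  have ff : f_ n j * f_ n j @[n --> G] --> f j * f j by exact: cvgM.
  rewrite fi subr0; apply: (cvgr_to_ge ff).
  by apply: filterS fG => n [_ _ /ltW].
apply: (@le_trans _ _ ((m + e)%:E)); first by rewrite lee_fin; lra.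
rewrite EFinD leeD2r//; apply: ereal_sup_ge.
exists ((f i - f j) ^+ 2 / finite_energy c f)%:E.
  right; exists f; last by rewrite real_normK ?num_real.
  by split=> // /cE; rewrite Ef => /eqP; rewrite oner_eq0.
by rewrite lee_fin Ef divr1 -opprB sqrrN.
Unshelve. all: by end_near. Qed.

(** * Sets converging for the Hausdorff distance *)

(** At each index [n], take a witness for the largest level [k <= n] that has
    one. *)
Lemma diagonal_choice (T : nat -> Type) (P : nat -> forall n, T n -> Prop) :
  (forall n, T n) -> (forall k n t, P k.+1 n t -> P k n t) ->
  (forall k, \forall n \near \oo, exists t, P k n t) ->
  exists t : forall n, T n, forall k, \forall n \near \oo, P k n (t n).
Proof.
move=> t0 Pmono Pex.
have best n m : exists t : T n, forall k, (k <= m)%N ->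
    (exists t', P k n t') -> P k n t.
  elim: m => [|m [t IH]].
    have [[t Pt]|nP] := pselect (exists t, P 0%N n t).
      by exists t => k; rewrite leqn0 => /eqP ->.
    by exists (t0 n) => k; rewrite leqn0 => /eqP -> /nP.
  have [[t' Pt']|nP] := pselect (exists t, P m.+1 n t); last first.
    by exists t => k; rewrite leq_eqVlt => /orP[/eqP -> /nP|] //; exact: IH.
  have down j k : P (j + k)%N n t' -> P k n t' by elim: j => // j IHj /Pmono.
  by exists t' => k km _; apply: (down (m.+1 - k)%N); rewrite subnK.
exists (fun n => sval (cid (best n n))) => k.
near=> n; case: cid => t /= tP; apply: tP; near: n; last exact: Pex.
exact: nbhs_infty_ge.
Unshelve. all: by end_near. Qed.

(** Splicing: if infinitely many indices carried a bad point close to the limit,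
    these points could be inserted into one convergent sequence, along which the
    values would not converge. *)
Lemma sequential_locally_uniform (R : realType) (T : nat -> Type)
    (rho phi : forall n, T n -> R) (l : R) (t0 : forall n, T n) :
  let tends (t : forall n, T n) :=
    forall d, 0 < d -> \forall n \near \oo, rho n (t n) < d in
  tends t0 -> (forall t, tends t -> phi n (t n) @[n --> \oo] --> l) ->
  forall e, 0 < e -> exists2 d, 0 < d &
    \forall n \near \oo, forall t, rho n t < d -> `|l - phi n t| < e.
Proof.
move=> tends t0P phiP e e0; apply/not_exists2P => bad.
pose Bad k n (t : T n) := rho n t < k.+1%:R^-1 /\ ~ `|l - phi n t| < e.
have ex_bad k : exists n, (k <= n)%N /\ exists t, Bad k n t.
  have [|bk] := bad k.+1%:R^-1; first by rewrite invr_gt0.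
  apply: contra_notP bk => nb; exists k => // n /= kn t rt.
  by apply: contrapT => ln; apply: nb; exists n; split=> //; exists t.
have [m mP] := choice ex_bad.
have splice n : exists t : T n, (exists2 k, m k = n & Bad k n t) \/
    (forall k, m k <> n) /\ t = t0 n.
  have [[k kn]|nk] := pselect (exists k, m k = n).
    by have [_ [u uP]] := mP k; rewrite -kn; exists u; left; exists k.
  by exists (t0 n); right; split=> // k kn; apply: nk; exists k.
pose u n := sval (cid (splice n)).
have uP n : (exists2 k, m k = n & Bad k n (u n)) \/
    (forall k, m k <> n) /\ u n = t0 n by rewrite /u; case: cid.
have late k : \forall n \near \oo, forall j, m j = n -> (k < j)%N.
  exists (\max_(i < k.+1) m i).+1 => // n /= nk j jn; rewrite ltnNge.
  apply/negP => jk; move: nk; rewrite -jn ltnNge => /negP; apply.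
  by rewrite -ltnS in jk; exact: (leq_bigmax (Ordinal jk)).
have u_tends : tends u.
  move=> d d0; have [k _ kd] := near_infty_natSinv_lt (PosNum d0).
  near=> n; have [[j jn []]|[_ ->]] := uP n.
    move=> + _ => /lt_trans; apply; apply: kd => /=; apply/ltnW.
    by move: j jn; near: n; exact: late.
  by near: n; exact: t0P.
have /cvgrPdist_lt/(_ e e0)[N _ NP] := phiP _ u_tends.
have [Nm _] := mP N; have := NP _ Nm; have [[k kn [_ //]]|[]] := uP (m N).
by move=> /(_ N).
Unshelve. all: by end_near. Qed.

Section Hausdorff.
Context {R : realType} {B : metricType R} (A_ : nat -> set B) (A : set B).
Hypothesis An0 : forall n, A_ n !=set0.
Hypothesis AA : hausdorff_dist (A_ n) A @[n --> \oo] --> 0%E.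

Lemma hausdorff_near e : 0 < e -> \forall n \near \oo,
  (forall y : A_ n, exists x : A, mdist (val x) (val y) < e) /\
  (forall x : A, exists y : A_ n, mdist (val x) (val y) < e).
Proof.
move=> e0; have : \forall n \near \oo, (hausdorff_dist (A_ n) A < e%:E)%E.
  move: AA => /(_ [set x | (x < e%:E)%E]); apply.
  exact: (@nbhs_open_ereal_lt _ 0 (fun=> e)).
apply: filterS => n /ereal_inf_lt[_ [rho [_ sAA' sA'A] <-]].
rewrite lte_fin => rho_e; split.
  move=> [y /[dup] Ay /set_mem /sAA'[x Ax /= xy]].
  by exists (exist _ x (mem_set Ax)) => /=; exact: lt_trans rho_e.
move=> [y /[dup] Ay /set_mem /sA'A[x Ax /= xy]].
exists (exist _ x (mem_set Ax)) => /=; rewrite metric_sym.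
exact: lt_trans rho_e.
Qed.

Definition some_point n : A_ n :=
  let: exist x Ax := cid (An0 n) in exist _ x (mem_set Ax).

Lemma hausdorff_approx (x : A) : exists x_ : forall n, A_ n,
  (val (x_ n) : B) @[n --> \oo] --> (val x : B).
Proof.
have [|k|x_ xP] := @diagonal_choice (fun n => A_ n)
  (fun k n t => mdist (val x) (val t) < k.+1%:R^-1) some_point.
- move=> k n t /lt_trans; apply.
  by rewrite ltf_pV2 ?posrE// ltr_nat.
- by apply: filterS (hausdorff_near (e := k.+1%:R^-1) _) => // n [].
exists x_; apply/metricType_numDomainType.cvgrPdist_lt => e e0.
have [k _ /(_ _ (leqnn k)) ke] := near_infty_natSinv_lt (PosNum e0).
by apply: filterS (xP k) => n /lt_trans; apply.
Qed.

(** Near a point off [A] there is nothing to check, since the approximating sets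
    eventually avoid a ball around it; compactness of [B] then makes the local
    statements uniform. *)
Lemma near_hausdorff (P : forall n, A_ n -> Prop) :
  compact [set: B] -> closed A ->
  (forall x : A, exists2 d, 0 < d & \forall n \near \oo,
     forall y : A_ n, mdist (val x) (val y) < d -> P n y) ->
  \forall n \near \oo, forall y, P n y.
Proof.
move=> /compact_near_coveringP cB cA loc.
have : \forall n \near \oo, [set: B] `<=`
    [set b | forall y : A_ n, val y = b -> P n y].
  apply: cB => b _; have [Ab|nAb] := pselect (A b).
    have [d d0 dP] := loc (exist _ b (mem_set Ab)).
    near=> b' n.
    have bb' : mdist b b' < d.
      by near: b'; apply/nbhs_ballP; exists d => //=; rewrite ballEmdist.
    have Pd : forall y : A_ n, mdist b (val y) < d -> P n y by near: n.
    by move=> y yb'; apply: Pd; rewrite yb'.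
  have : nbhs b (~` A) by apply: open_nbhs_nbhs; split=> //; exact: closed_openC.
  move=> /nbhs_ballP[d /= d0]; rewrite ballEmdist => dA.
  have d2 : 0 < d / 2 by rewrite divr_gt0.
  near=> b' n.
  have bb' : mdist b b' < d / 2.
    by near: b'; apply/nbhs_ballP; exists (d / 2) => //=; rewrite ballEmdist.
  have : (forall y : A_ n, exists x : A, mdist (val x) (val y) < d / 2) /\
    (forall x : A, exists y : A_ n, mdist (val x) (val y) < d / 2).
    by near: n; exact: hausdorff_near.
  move=> [xA _] y yb'; have [x xy] := xA y.
  exfalso; apply: (dA (val x)); last by have := valP x; rewrite inE.
  have by_ : mdist b (val y) < d / 2 by have -> : val y = b' := yb'.
  rewrite /= (splitr d).
  apply: le_lt_trans (metric_triangle b (val y) (val x)) _.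
  by apply: ltrD => //; rewrite metric_sym.
by apply: filterS => n nP y; exact: nP.
Unshelve. all: by end_near. Qed.

Section LocallyUniform.
Variables (r_ : forall n, A_ n -> A_ n -> R) (r : A -> A -> R).
Arguments r_ n _ _ : clear implicits.
Hypothesis rr : metric_cvg r_ r.

Lemma metric_cvg_locally_uniform (x y : A) e : 0 < e ->
  exists2 d, 0 < d & \forall n \near \oo, forall x' y' : A_ n,
    mdist (val x) (val x') < d -> mdist (val y) (val y') < d ->
    `|r x y - r_ n x' y'| < e.
Proof.
move=> e0.
have [x0 x0P] := hausdorff_approx x; have [y0 y0P] := hausdorff_approx y.
have [||d d0 dP] := @sequential_locally_uniform R (fun n => A_ n * A_ n)%type
  (fun n t => Num.max (mdist (val x) (val t.1)) (mdist (val y) (val t.2)))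
  (fun n t => r_ n t.1 t.2) (r x y) (fun n => (x0 n, y0 n)) _ _ e e0.
- move=> d d0; near=> n; rewrite gt_max; apply/andP; split; near: n.
    exact: (metricType_numDomainType.cvgr_dist_lt x0P).
  exact: (metricType_numDomainType.cvgr_dist_lt y0P).
- move=> t tP; apply: (rr (x_ := fun n => (t n).1) (y_ := fun n => (t n).2));
  apply/metricType_numDomainType.cvgrPdist_lt => d /tP;
  by apply: filterS => n; rewrite gt_max => /andP[].
- exists d => //; apply: filterS dP => n dP x' y' xx' yy'.
  by apply: (dP (x', y')); rewrite gt_max xx'.
Unshelve. all: by end_near. Qed.

(** Near [x] and [y], both [r x y] and [r] at the neighbouring points are close to
    the same values of [r_ n]. *)
Lemma metric_cvg_continuous : continuous (fun p : A * A => r p.1 p.2).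
Proof.
move=> [x y]; apply/cvgrPdist_lt => e e0 /=.
have e2 : 0 < e / 2 by rewrite divr_gt0.
have [d d0 dP] := metric_cvg_locally_uniform x y e2.
have d2 : 0 < d / 2 by rewrite divr_gt0.
have ballA (z : A) : \forall z' \near z, mdist (val z) (val z') < d / 2.
  apply: (@initial_continuous A B val z [set b | mdist (val z) b < d / 2]).
  apply/nbhs_ballP; exists (d / 2) => //=.
  by rewrite ballEmdist.
near=> p.
have px : mdist (val x) (val p.1) < d / 2.
  near: p; exact: (@cvg_fst _ _ (nbhs x) (nbhs y) _ _ (ballA x)).
have py : mdist (val y) (val p.2) < d / 2.
  near: p; exact: (@cvg_snd _ _ (nbhs x) (nbhs y) _ _ (ballA y)).
have [c c0 cP] := metric_cvg_locally_uniform p.1 p.2 e2.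
near \oo => n.
have [] : (forall y : A_ n, exists x : A,
     mdist (val x) (val y) < Num.min c (d / 2)) /\
  (forall x : A, exists y : A_ n, mdist (val x) (val y) < Num.min c (d / 2)).
  by near: n; apply: hausdorff_near; rewrite lt_min c0 d2.
move=> _ /[dup] /(_ p.1)[x' xx'] /(_ p.2)[y' yy'].
move: xx' yy'; rewrite !lt_min => /andP[xc xd] /andP[yc yd].
have r1 : `|r x y - r_ n x' y'| < e / 2.
  have : forall x' y' : A_ n, mdist (val x) (val x') < d ->
    mdist (val y) (val y') < d -> `|r x y - r_ n x' y'| < e / 2 by near: n.
  apply; rewrite (splitr d).
    exact: le_lt_trans (metric_triangle _ (val p.1) _) (ltrD px xd).
  exact: le_lt_trans (metric_triangle _ (val p.2) _) (ltrD py yd).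
have r2 : `|r p.1 p.2 - r_ n x' y'| < e / 2.
  have : forall x' y' : A_ n, mdist (val p.1) (val x') < c ->
    mdist (val p.2) (val y') < c -> `|r p.1 p.2 - r_ n x' y'| < e / 2 by near: n.
  exact.
rewrite (splitr e) -(subrKA (r_ n x' y')).
by apply: le_lt_trans (ler_normD _ _) _; rewrite ltrD// distrC.
Unshelve. all: by end_near. Qed.

End LocallyUniform.
End Hausdorff.

(** * The limit of resistance metrics *)

Lemma resistance_metricxx (R : realType) (X : choiceType) (r : X -> X -> R) :
  resistance_metric r -> forall x, r x x = 0.
Proof.
move=> rm x; have [E _] := rm [fset x]%fset.
move=> /(_ (FSetSub (fset11 x)) (FSetSub (fset11 x))).
rewrite resistance_sup_xx /= => -[].
exact.
Qed.

Lemma network_bij (R : realType) (I J : finType) (s : I -> J) (t : J -> I)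
    (c : J -> J -> R) (rho : J -> J -> R) : cancel s t -> cancel t s ->
  network c rho -> network (fun i j => c (s i) (s j)) (fun i j => rho (s i) (s j)).
Proof.
move=> st ts [c0 cs cE rhoE].
have s_bij : bijective s by exists t.
have energyE f : finite_energy (fun i j => c (s i) (s j)) f =
    finite_energy c (f \o t).
  rewrite /finite_energy [in RHS](reindex s)/=; last exact: onW_bij.
  congr (_ * _); apply: eq_bigr => i _.
  rewrite [in RHS](reindex s)/=; last exact: onW_bij.
  apply: eq_big => [j|j _]; last by rewrite !st.
  by rewrite (inj_eq (bij_inj s_bij)).
have cstE f : constant_fun f <-> constant_fun (f \o t).
  split=> [[a ->]|[a fa]]; first by exists a.
  by exists a; apply/funext => i; rewrite -(st i); exact: (congr1 (@^~ (s i)) fa).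
split=> // [f|i j].
  by rewrite energyE; split=> [/cE/cstE|/cstE/cE].
rewrite rhoE; congr (ereal_sup (_ `|` _)); apply/seteqP; split=> _ [f [_ nf] <-].
  exists (f \o s).
    by split=> // /cstE; rewrite -compA (_ : s \o t = id)//; apply/funext.
  by rewrite energyE -compA (_ : s \o t = id)//; apply/funext.
exists (f \o t); last by rewrite energyE /= !st.
by split=> // /cstE.
Qed.

(** Indexing by a fixed finite type, instead of finite subsets, makes the
    networks carried by different spaces comparable. *)
Lemma resistance_metric_network (R : realType) (X : choiceType)
    (r : X -> X -> R) (I : finType) (p : I -> X) :
  resistance_metric r -> injective p ->
  exists c, network c (fun i j => r (p i) (p j)).
Proof.
move=> rm p_inj; pose V := [fset p i | i in I]%fset.
have pV i : p i \in V by apply/imfsetP; exists i.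
have [E [c [c0 cs -> cE]] rE] := rm V.
pose s i : V := FSetSub (pV i).
have s_inj : injective s by move=> i j /(congr1 val) /p_inj.
have /choice[t ts] : forall v : V, exists i, s i = v.
  move=> v; have /imfsetP[i _ vi] := valP v.
  by exists i; apply: val_inj.
have st : cancel s t by move=> i; apply: s_inj; rewrite ts.
exists (fun i j => c (s i) (s j)).
exact: (network_bij st ts (rho := fun v w => r (val v) (val w))).
Qed.

Lemma network_resistance_metric (R : realType) (X : choiceType) (r : X -> X -> R) :
  (forall V : {fset X}, exists c, network c (fun v w : V => r (val v) (val w))) ->
  resistance_metric r.
Proof.
move=> net V; have [c [c0 cs cE rE]] := net V.
by exists (finite_energy c); [exists c | exact: rE].
Qed.

Section LimitIsResistance.
Context {R : realType} {B : metricType R} (A_ : nat -> set B) (A : set B).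
Variables (r_ : forall n : nat, A_ n -> A_ n -> R) (r : A -> A -> R).
Arguments r_ n _ _ : clear implicits.

(** A finite subset of [A] is followed by its approximations in [A_ n]; as [r]
    separates its points, these approximations are eventually distinct. *)
Lemma metric_cvg_resistance_metric (proj : forall n, A -> A_ n) :
  (forall x : A, (val (proj n x) : B) @[n --> \oo] --> (val x : B)) ->
  (forall n, resistance_metric (r_ n)) -> is_metric r -> metric_cvg r_ r ->
  resistance_metric r.
Proof.
move=> projP rm [r0 r_eq0 _ _] rr; apply: network_resistance_metric => V.
have rV (v w : V) : r_ n (proj n (val v)) (proj n (val w)) @[n --> \oo] -->
  r (val v) (val w) by apply: rr.
have r_gt0 (v w : V) : v != w -> 0 < r (val v) (val w).
  move=> vw; rewrite lt0r r0 andbT; apply: contra_neq vw => /r_eq0.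
  exact: val_inj.
apply: (network_limit _ rV) => [|v|v w]; last exact: r_gt0.
- have sep : \forall n \near \oo, forall v w : V, v != w ->
      0 < r_ n (proj n (val v)) (proj n (val w)).
    apply: filter_forall => v; apply: filter_forall => w.
    have [->|vw] := eqVneq v w; first exact: nearW.
    by near=> n => _; near: n; exact: (cvgr_gt _ (rV v w) _ (r_gt0 _ _ vw)).
  apply: filterS sep => n sep.
  apply: (resistance_metric_network (p := fun v : V => proj n (val v)) (rm n)).
  move=> v w pvw; apply/eqP; apply: contraT => /sep.
  by rewrite pvw resistance_metricxx// ltxx.
- by apply/r_eq0.
Unshelve. all: by end_near. Qed.

End LimitIsResistance.

(** * Gamma-convergence of the energies *)

Lemma limn_einf_ge (R : realType) (u : nat -> \bar R) (M : R) :
  (\forall n \near \oo, (M%:E <= u n)%E) -> (M%:E <= limn_einf u)%E.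
Proof.
move=> [N _ NP].
rewrite limn_einf_lim (cvg_lim _ (@cvg_einfs_sup _ u))//.
apply: (@le_trans _ _ (einfs u N)); last by apply: ereal_sup_ubound; exists N.
by apply: le_ereal_inf_tmp => _ [n /= Nn <-]; exact: NP.
Qed.

Lemma continuous_pair_cst (T U : topologicalType) (y : U) :
  continuous (fun x : T => (x, y)).
Proof.
move=> x; exact: (@cvg_pair T T U (nbhs x) (nbhs x) (nbhs y) _ _ _
  id (fun=> y) (@cvg_id _ _) (@cvg_cst _ y _ _ _)).
Qed.

Lemma continuous_cst_pair (T U : topologicalType) (y : U) :
  continuous (fun x : T => (y, x)).
Proof.
move=> x; exact: (@cvg_pair T U T (nbhs x) (nbhs y) (nbhs x) _ _ _
  (fun=> y) id (@cvg_cst _ y _ _ _) (@cvg_id _ _)).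
Qed.

Lemma lee_from_below (R : realType) (x y : \bar R) :
  (forall M : R, (M%:E < x)%E -> (M%:E <= y)%E) -> (x <= y)%E.
Proof.
case: x y => [x||] [y||] xy //; rewrite ?leey ?leNye//.
- rewrite lee_fin leNgt; apply/negP => yx.
  have := xy ((x + y) / 2)%R; rewrite lte_fin lee_fin => /(_ ltac:(lra)); lra.
- by have := xy (x - 1)%R; rewrite lte_fin ltrBlDr ltrDl ltr01 => /(_ isT).
- by have := xy (y + 1)%R; rewrite ltry lee_fin => /(_ isT); rewrite gerDl ler10.
- by have := xy 0; rewrite ltry => /(_ isT).
Qed.

Lemma uniform_cvgP (R : realType) (T : choiceType) (f_ : nat -> T -> R) (f : T -> R) :
  {uniform, f_ @ \oo --> f} <->
  forall e, 0 < e -> \forall n \near \oo, forall x, `|f x - f_ n x| < e.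
Proof.
split=> [fP e e0|fP P /uniform_nbhs[E [+ sP]]].
  have := fP [set g | forall x, `|f x - g x| < e]; apply.
  apply/uniform_nbhs; exists [set xy | ball xy.1 e xy.2].
  split; first exact: (entourage_ball _ (PosNum e0)).
  by move=> g gP x; exact: gP.
rewrite -entourage_ballE => -[e /= e0 eE].
have := fP e e0; rewrite /fmap/=; apply: filterS => n nP.
by apply: sP => x _; apply: eE; exact: nP.
Qed.

Lemma valL_val (T : choiceType) (U : Type) (D : set T) (u : U) (f : D -> U)
  (x : D) : valL_ u f (val x) = f x.
Proof. exact: (congr1 (@^~ x) (@valLK _ _ u D f)). Qed.

Section EnergyLowerBound.
Context {R : realType} {X : choiceType}.
Variables (Q : resistance_form R X) (r : X -> X -> R) (o : X).
Hypothesis rxx : forall x, r x x = 0.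
Hypothesis Qr : associated Q r.

(** This is [green_sum_riesz] read with the value [+oo] off the domain. *)
Lemma energy_gt f (M : R) : (M%:E < energy Q f)%E ->
  exists s, M < 2 * charge_pairing f o s - green_energy r o s.
Proof.
move=> ME; apply: contrapT => nM.
have [|df fM _] := @green_sum_riesz _ _ _ _ rxx Qr o f M.
  by move=> s; rewrite leNgt; apply/negP => sM; apply: nM; exists s.
by move: ME; rewrite /energy (mem_set df) lte_fin ltNge fM.
Qed.

Lemma energy_ge f s :
  ((2 * charge_pairing f o s - green_energy r o s)%:E <= energy Q f)%E.
Proof.
rewrite /energy; case: ifPn => [/set_mem df|_]; last by rewrite leey.
by rewrite lee_fin; exact: charge_pairing_le.
Qed.

End EnergyLowerBound.

Section GammaConvergence.
Context {R : realType} {B : metricType R} (A_ : nat -> set B) (A : set B).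
Variables (r_ : forall n : nat, A_ n -> A_ n -> R) (r : A -> A -> R).
Arguments r_ n _ _ : clear implicits.
Hypothesis cB : compact [set: B].
Hypothesis An0 : forall n, A_ n !=set0.
Hypothesis cA : compact A.
Hypothesis cA_ : forall n, compact (A_ n).
Hypothesis AA : hausdorff_dist (A_ n) A @[n --> \oo] --> 0%E.
Hypothesis r_c : forall n, continuous (fun p : A_ n * A_ n => r_ n p.1 p.2).
Hypothesis rn_xx : forall n x, r_ n x x = 0.
Hypothesis rxx : forall x, r x x = 0.
Hypothesis rr : metric_cvg r_ r.
Variables (Q_ : forall n, resistance_form R (A_ n)) (Q : resistance_form R A).
Arguments Q_ n : clear implicits.
Hypothesis Qr_ : forall n, associated (Q_ n) (r_ n).
Hypothesis Qr : associated Q r.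

Variable proj : forall n, A -> A_ n.
Arguments proj n _ : clear implicits.
Hypothesis projP : forall x : A, (val (proj n x) : B) @[n --> \oo] --> (val x : B).
Variable o : A.

Let push n (s : seq (R * A)) : seq (R * A_ n) := [seq (t.1, proj n t.2) | t <- s].

Lemma cvg_green (x y : A) (x_ y_ : forall n, A_ n) :
  (val (x_ n) : B) @[n --> \oo] --> (val x : B) ->
  (val (y_ n) : B) @[n --> \oo] --> (val y : B) ->
  green (r_ n) (proj n o) (x_ n) (y_ n) @[n --> \oo] --> green r o x y.
Proof.
move=> xP yP; apply: cvgMl; apply: cvgB; last exact: rr.
by apply: cvgD; apply: rr.
Qed.

Lemma cvg_green_sum (s : seq (R * A)) (y : A) (y_ : forall n, A_ n) :
  (val (y_ n) : B) @[n --> \oo] --> (val y : B) ->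
  green_sum (r_ n) (proj n o) (push n s) (y_ n) @[n --> \oo] --> green_sum r o s y.
Proof.
move=> yP; rewrite /green_sum.
under eq_fun do rewrite big_map.
by apply: cvg_sum => t _ /=; apply: cvgMr; exact: cvg_green.
Qed.

Lemma cvg_green_energy (s : seq (R * A)) :
  green_energy (r_ n) (proj n o) (push n s) @[n --> \oo] --> green_energy r o s.
Proof.
rewrite /green_energy; under eq_fun do rewrite big_map.
by apply: cvg_sum => t _ /=; apply: cvgMr; exact: cvg_green_sum.
Qed.

Lemma cvg_charge_pairing (f_ : nat -> B -> R) (f : B -> R) (s : seq (R * A)) :
  continuous f -> {uniform, f_ @ \oo --> f} ->
  charge_pairing (f_ n \o val) (proj n o) (push n s) @[n --> \oo]
    --> charge_pairing (f \o val) o s.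
Proof.
move=> cf /uniform_cvgP ff.
have fproj x : f_ n (val (proj n x)) @[n --> \oo] --> f (val x).
  apply/cvgrPdist_lt => e e0; have e2 : 0 < e / 2 by rewrite divr_gt0.
  have /cvgrPdist_lt/(_ _ e2) fx : f (val (proj n x)) @[n --> \oo] --> f (val x).
    exact: (@cvg_comp _ _ _ (fun n => val (proj n x)) f _ _ _ (@projP x) (cf (val x))).
  near=> n; rewrite (splitr e) -(subrKA (f (val (proj n x)))).
  apply: le_lt_trans (ler_normD _ _) _; apply: ltrD; near: n => //.
  by apply: filterS (ff _ e2) => n; exact.
rewrite /charge_pairing; under eq_fun do rewrite big_map.
by apply: cvg_sum => t _ /=; apply: cvgMr; apply: cvgB; exact: fproj.
Unshelve. all: by end_near. Qed.

(** A single finite charge on [A] witnesses that the energy exceeds [M]; carried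
    over to [A_ n] it does so eventually, by convergence on finite sets. *)
Lemma Gamma_liminf (f_ : nat -> B -> R) (f : B -> R) (M : R) :
  continuous f -> {uniform, f_ @ \oo --> f} ->
  (M%:E < energy Q (f \o val))%E ->
  \forall n \near \oo, (M%:E < energy (Q_ n) (f_ n \o val))%E.
Proof.
move=> cf ff /(energy_gt o rxx Qr)[s Ms].
have Js : 2 * charge_pairing (f_ n \o val) (proj n o) (push n s)
      - green_energy (r_ n) (proj n o) (push n s) @[n --> \oo]
    --> 2 * charge_pairing (f \o val) o s - green_energy r o s.
  apply: cvgB; last exact: cvg_green_energy.
  by apply: cvgMr; exact: cvg_charge_pairing.
have Jn := cvgr_gt _ Js _ Ms; near=> n.
have Mn : M < 2 * charge_pairing (f_ n \o val) (proj n o) (push n s)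
    - green_energy (r_ n) (proj n o) (push n s) by near: n; exact: Jn.
have := energy_ge (proj n o) (@rn_xx n) (@Qr_ n) (f_ n \o val) (push n s).
apply: lt_le_trans.
by rewrite lte_fin.
Unshelve. all: by end_near. Qed.

Lemma resistance_bounded : exists2 D, 0 < D & forall x : A, r x o <= D.
Proof.
have cr : continuous (fun x : A => r x o).
  move=> x; have := metric_cvg_continuous An0 AA rr (x := (x, o)).
  move=> rxo; apply: (@cvg_comp _ _ _ (fun y : A => (y, o)) _ _ _ _ _ rxo).
  exact: continuous_pair_cst.
have /continuous_compact/(_ cA)/compact_bounded[M [_ MP]] :
  {within A, continuous (valL_ 0 (fun x : A => r x o))}.
  exact/subspace_valL_continuousP'.
pose D := `|M| + 1; exists D; first by rewrite ltr_wpDl.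
move=> x; apply: le_trans (ler_norm _) _.
apply: (MP D); first by rewrite /D; have := ler_norm M; lra.
by exists (val x); [have := valP x; rewrite inE | rewrite valL_val].
Qed.

(** The function [f] is close, in energy and uniformly on [A], to a constant plus
    the potential of a finite charge. On [A_ n] the same charge has a potential
    of nearly the same energy; with the constant added it is uniformly close to
    [f], so that extending the difference to [B] by Tietze's theorem corrects [f]
    only slightly. *)
Lemma recovery_approx (f : B -> R) e : continuous f -> rf_dom Q (f \o val) ->
  0 < e -> \forall n \near \oo, exists g : B -> R,
    [/\ continuous g, forall b, `|f b - g b| <= e, rf_dom (Q_ n) (g \o val)
      & `|rf_form Q (f \o val) (f \o val)
          - rf_form (Q_ n) (g \o val) (g \o val)| < e].
Proof.
move=> cf df e0; have [D D0 rD] := resistance_bounded.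
have e2 : 0 < e / 2 by rewrite divr_gt0.
pose eta := Num.min (e / 2) ((e / 2) ^+ 2 / D).
have eta0 : 0 < eta by rewrite lt_min e2 divr_gt0 ?exprn_gt0.
have [s [close energy_close]] := green_sum_dense rxx Qr o df eta0.
(* The difference vanishes at [o], so its energy controls it everywhere. *)
have sA x : `|green_sum r o s x + f (val o) - f (val x)| < e / 2.
  have [ds _] := green_sum_representer rxx Qr o s.
  have sx : (f (val x) - green_sum r o s x - f (val o)) ^+ 2 <=
      r x o * rf_form Q (f \o val \- green_sum r o s)
                        (f \o val \- green_sum r o s).
    have := form_sqr_diff_le rxx Qr x o (dom_sub df ds).
    by rewrite /= green_sum_base// subr0.
  rewrite -(@ltr_pXn2r _ 2) ?nnegrE ?(ltW e2)// real_normK ?num_real//.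
  have -> : (green_sum r o s x + f (val o) - f (val x)) ^+ 2 =
    (f (val x) - green_sum r o s x - f (val o)) ^+ 2 by ring.
  apply: le_lt_trans sx _.
  apply: (@le_lt_trans _ _ (D * rf_form Q (f \o val \- green_sum r o s)
                                         (f \o val \- green_sum r o s))).
    by rewrite ler_wpM2r// rf1_ge0//; exact: dom_sub.
  by rewrite mulrC -ltr_pdivlMr//; apply: lt_le_trans close _; rewrite ge_min lexx orbT.
pose gap n (y : A_ n) : R :=
  green_sum (r_ n) (proj n o) (push n s) y + f (val o) - f (val y).
have gap_small : \forall n \near \oo, forall y, `|gap n y| <= e.
  apply: (near_hausdorff AA (P := fun n y => `|gap n y| <= e) cB).
    exact: compact_closed (@metric_hausdorff R B) cA.
  move=> x.
  have [||d d0 dP] := @sequential_locally_uniform R (fun n => A_ n)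
    (fun n y => mdist (val x) (val y)) gap
    (green_sum r o s x + f (val o) - f (val x)) (fun n => proj n x) _ _ _ e2.
  - by move=> d d0; apply: (metricType_numDomainType.cvgr_dist_lt (@projP x)).
  - move=> y_ /metricType_numDomainType.cvgrPdist_lt yP.
    apply: cvgB; first by apply: cvgD; [exact: cvg_green_sum|exact: cvg_cst].
    exact: (@cvg_comp _ _ _ (fun n => val (y_ n)) f _ _ _ yP (cf (val x))).
  exists d => //; apply: filterS dP => n dP y /dP; rewrite distrC => xy.
  rewrite -[gap n y](subrK (green_sum r o s x + f (val o) - f (val x))) (splitr e).
  by apply: le_trans (ler_normD _ _) _; apply: lerD; apply: ltW.
have gap_continuous n : continuous (gap n).
  move=> y.
  have fy : f (val z) @[z --> y] --> f (val y).
    apply: (@cvg_comp _ _ _ (fun z : A_ n => val z) f _ _ _ _ (cf (val y))).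
    exact: initial_continuous.
  have cr (F : A_ n -> A_ n * A_ n) : F z @[z --> y] --> F y ->
      r_ n (F z).1 (F z).2 @[z --> y] --> r_ n (F y).1 (F y).2.
    by move=> cF; apply: (@cvg_comp _ _ _ F _ _ _ _ cF (@r_c n (F y))).
  have gy x : green (r_ n) (proj n o) x z @[z --> y] --> green (r_ n) (proj n o) x y.
    have r1 := cr _ (@continuous_pair_cst (A_ n) (A_ n) (proj n o) y).
    have r2 := cr _ (@continuous_cst_pair (A_ n) (A_ n) x y).
    exact: (cvgMl (cvgB (cvgD (cvg_cst (r_ n x (proj n o))) r1) r2)).
  have sy : green_sum (r_ n) (proj n o) (push n s) z @[z --> y] -->
      green_sum (r_ n) (proj n o) (push n s) y.
    by apply: (@cvg_sum _ _ _ (nbhs y)) => t _; exact: (cvgMr (gy t.2)).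
  exact: (cvgB (cvgD sy (cvg_cst _)) fy).
have energy_cvg : \forall n \near \oo,
    `|green_energy r o s - green_energy (r_ n) (proj n o) (push n s)| < e / 2.
  by have /cvgrPdist_lt/(_ _ e2) := @cvg_green_energy s.
near=> n.
have gap_e : forall y, `|gap n y| <= e by near: n.
have [||g0 [gE cg g0e]] := @continuous_bounded_extension B R pseudometric_normal
    (A_ n) (compact_closed (@metric_hausdorff R B) (@cA_ n)) (valL_ 0 (gap n)) e e0.
- by apply/subspace_valL_continuousP'; exact: gap_continuous.
- by move=> b Ab; rewrite (valL_val _ _ (exist _ b (mem_set Ab))).
pose g b := f b + g0 b.
have gA (y : A_ n) : g (val y) = green_sum (r_ n) (proj n o) (push n s) y + f (val o).
  rewrite /g -gE; last exact: valP.
  by rewrite valL_val /gap; ring.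
have [ds _] := green_sum_representer (@rn_xx n) (@Qr_ n) (proj n o) (push n s).
have [dg gE'] := form_shift (f := g \o val) ds gA.
exists g; split=> //.
- by move=> b; apply: cvgD; [exact: cf|exact: cg].
- by move=> b; rewrite /g opprD addNKr normrN.
rewrite gE' (green_sum_energy (@rn_xx n) (@Qr_ n)) (splitr e) -(subrKA (green_energy r o s)).
apply: le_lt_trans (ler_normD _ _) _; apply: ltrD; last by near: n.
by apply: lt_le_trans energy_close _; rewrite ge_min lexx.
Unshelve. all: by end_near. Qed.

Lemma Gamma_recovery (f : B -> R) : continuous f ->
  exists f_ : nat -> B -> R, [/\ forall n, continuous (f_ n),
    {uniform, f_ @ \oo --> f}
    & energy (Q_ n) (f_ n \o val) @[n --> \oo] --> energy Q (f \o val)].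
Proof.
move=> cf; have [df|ndf] := pselect (rf_dom Q (f \o val)); last first.
  have ff : {uniform, (fun=> f) @ \oo --> f}.
    by apply/uniform_cvgP => e e0; apply: nearW => n x; rewrite subrr normr0.
  exists (fun=> f); split=> //.
  have Ey : energy Q (f \o val) = +oo%E by rewrite /energy memNset.
  rewrite Ey; apply/cvgeyPgt => M; apply: (Gamma_liminf cf ff).
  by rewrite Ey ltry.
pose P k n (g : {g : B -> R | continuous g}) :=
  [/\ forall b, `|f b - sval g b| <= k.+1%:R^-1, rf_dom (Q_ n) (sval g \o val)
    & `|rf_form Q (f \o val) (f \o val)
          - rf_form (Q_ n) (sval g \o val) (sval g \o val)| < k.+1%:R^-1].
have [|k n g [gf dg Eg]|k|g_ gP] := @diagonal_choice _ P.
- by move=> _; exists f.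
- have kk : k.+2%:R^-1 <= k.+1%:R^-1 :> R by rewrite lef_pV2 ?posrE// ler_nat.
  by split=> // [b|]; [exact: le_trans kk | exact: lt_le_trans kk].
- have := @recovery_approx f k.+1%:R^-1 cf df; rewrite invr_gt0 => /(_ (ltr0Sn _ _)).
  by apply: filterS => n [g [cg gf dg Eg]]; exists (exist _ g cg).
exists (fun n => sval (g_ n)); split.
- by move=> n; exact: (svalP (g_ n)).
- apply/uniform_cvgP => e e0.
  have [k _ /(_ _ (leqnn k)) ke] := near_infty_natSinv_lt (PosNum e0).
  by apply: filterS (gP k) => n [gf _ _] x; exact: le_lt_trans (gf x) ke.
rewrite {2}/energy (mem_set df).
have dg : \forall n \near \oo, rf_dom (Q_ n) (sval (g_ n) \o val).
  by apply: filterS (gP 0%N) => n [].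
apply: cvg_EFin.
  by apply: filterS dg => n dg; rewrite /energy (mem_set dg).
apply/cvgrPdist_lt => e e0.
have [k _ /(_ _ (leqnn k)) ke] := near_infty_natSinv_lt (PosNum e0).
apply: filterS (gP k) => n [_ dgn Eg]; rewrite /energy /= (mem_set dgn) /=.
exact: lt_trans Eg ke.
Qed.

End GammaConvergence.

(** * Convergence of resistance forms *)

Theorem theorem2p13 (R : realType) (B : metricType R)
  (A_ : nat -> set B) (A : set B)
  (r_ : forall n : nat, A_ n -> A_ n -> R) (r : A -> A -> R) :
  compact [set: B] ->
  (forall n, compact (A_ n)) ->
  (forall n, A_ n !=set0) ->
  compact A ->
  hausdorff_dist (A_ n) A @[n --> \oo] --> 0%E ->
  (forall n, resistance_metric (r_ n)) ->
  (forall n, continuous (fun p : A_ n * A_ n => r_ n p.1 p.2)) ->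
  is_metric r ->
  metric_cvg r_ r ->
  (resistance_metric r /\ continuous (fun p : A * A => r p.1 p.2)) /\
  (forall (Q_ : forall n : nat, resistance_form R (A_ n))
          (Q : resistance_form R A),
     (forall n, associated (Q_ n) (r_ n)) ->
     associated Q r ->
     Gamma_cvg Q_ Q).
Proof.
move=> cB cA_ An0 cA AA rm r_c r_metric rr.
have /choice[proj' proj'P] := hausdorff_approx An0 AA.
pose proj n x := proj' x n.
have projP x : (val (proj n x) : B) @[n --> \oo] --> (val x : B) by exact: proj'P.
have rn_xx n := resistance_metricxx (rm n).
have rxx x : r x x = 0 by have [_ r0 _ _] := r_metric; apply/r0.
have [x0 _] : exists x0 : A, True.
  have /filter_ex[n [+ _]] := hausdorff_near AA (e := 1) ltr01.
  by move=> /(_ (some_point An0 n))[x _]; exists x.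
split.
  split; last exact: (metric_cvg_continuous An0 AA rr).
  exact: (metric_cvg_resistance_metric projP rm r_metric rr).
move=> Q_ Q Qr_ Qr; split=> [f_ f _ cf ff|f cf]; last first.
  exact: (Gamma_recovery cB An0 cA cA_ AA r_c rn_xx rxx rr Qr_ Qr projP x0).
have le_M (M : R) : (M%:E < energy Q (f \o val))%E ->
    (M%:E <= limn_einf (fun n => energy (Q_ n) (f_ n \o val)))%E.
  move=> ME; apply: limn_einf_ge.
  have := Gamma_liminf rn_xx rxx rr Qr_ Qr projP x0 cf ff ME.
  by apply: filterS => n; exact: ltW.
exact: lee_from_below.
Qed.
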